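(* Let $(X_n)_{n\in\mathbb{N}}$ be a Markov chain on a finite state space $S$ with transition probability matrix $P$, and let $G=(S,E)$ and $\Phi:\mathbb{N}\times\mathcal{P}(S)\to\mathcal{P}(S)$ be its associated graph and semiflow. For a subset $C\subset S$ the following are equivalent: (1) $C$ is a maximal communicating class of the graph $G$; (2) $C$ is a stochastically closed communicating class of the Markov chain; (3) $C$ is a minimal (with respect to set inclusion) nonempty attractor of $\Phi$.
   Context: Markov chains are time-homogeneous; $p_n(i,j)$ is the $(i,j)$ entry of $P^n$ ($P^0=I$), and $p=p_1$. The associated graph $G=(S,E)$ has $(i,j)\in E$ iff $p(i,j)>0$. The associated semiflow is $\Phi(n,A)=\{j\in S:\text{there is } i\in A\text{ with }p_n(i,j)>0\}$. Write $i\sim j$ if there are directed paths of length $\ge 1$ in $G$ from $i$ to $j$ and from $j$ to $i$; let $V_c=\{i\in S:i\sim j \text{ for some } j\in S\}$; the communicating classes of $G$ are the sets $[i]=\{j\in S: j\sim i\}$, $i\in V_c$. They are partially ordered by $C_\mu\preceq C_\nu$ iff there is a path in $G$ from some vertex of $C_\mu$ to some vertex of $C_\nu$; ''maximal communicating class'' means maximal with respect to $\preceq$. States $i,j$ communicate via the Markov chain if $p_n(i,j)>0$ and $p_m(j,i)>0$ for some $n,m\ge 0$; the equivalence classes are the communicating classes of the chain. A nonempty set $A\subset S$ is stochastically closed if $\sum_{j\in A}p(i,j)=1$ for all $i\in A$. The $\omega$-limit set is $\omega(A)=\{y\in S:\text{ there are }t_k\to\infty\text{ with }y\in\Phi(t_k,A)\}$.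 A set $A\subset S$ is an attractor of $\Phi$ if there is $N\subset S$ with $A\subset N$ and $\omega(N)=A$. *)

(* Defs.v *)
From HB Require Import structures.
From mathcomp Require Import all_boot all_order all_algebra.
From mathcomp Require Import all_classical all_reals all_analysis.

Set Implicit Arguments.
Unset Strict Implicit.
Unset Printing Implicit Defensive.

Import Order.TTheory GRing.Theory Num.Theory.
Import numFieldNormedType.Exports.

Local Open Scope classical_set_scope.
Local Open Scope ring_scope.

(* A matrix indexed by the finite type S is a square matrix of size #|S| whose
   entries are addressed through the enumeration of S; subsets of S are
   classical sets. *)

Definition pn (R : realType) (S : finType) (P : 'M[R]_#|S|) (n : nat)
  (i j : S) : R := (P ^+ n) (enum_rank i) (enum_rank j).

Definition stochastic_mx (R : realType) (S : finType) (P : 'M[R]_#|S|) : Prop :=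
  (forall i j : S, 0 <= pn P 1 i j) /\
  (forall i : S, \sum_(j : S) pn P 1 i j = 1).

Section MarkovChain.
Variables (d : measure_display) (T : measurableType d) (R : realType).
Variables (Pr : probability T R) (S : finType).

Definition cond_prob (A B : set T) : R := fine (Pr (A `&` B)) / fine (Pr B).

Definition history (X : nat -> T -> S) (n : nat) (x : nat -> S) : set T :=
  [set w | forall k, (k <= n)%N -> X k w = x k].

(* No condition is put on the law of X 0. *)
Definition markov_chain (X : nat -> T -> S) (P : 'M[R]_#|S|) : Prop :=
  [/\ stochastic_mx P,
      forall n (i : S), measurable (X n @^-1` [set i]) &
      forall n (x : nat -> S) (j : S), (0 < Pr (history X n x))%E ->
        cond_prob (X n.+1 @^-1` [set j]) (history X n x) = pn P 1 (x n) j].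

End MarkovChain.

Section DirectedGraph.
Variables (S : finType) (e : rel S).

Definition dipath (n : nat) (i j : S) : Prop :=
  exists s : seq S, [/\ size s = n, path e i s & last i s = j].

Definition gsim (i j : S) : Prop :=
  (exists2 n, (1 <= n)%N & dipath n i j) /\
  (exists2 n, (1 <= n)%N & dipath n j i).

Definition Vc : set S := [set i | exists j, gsim i j].

Definition graph_comm_class (C : set S) : Prop :=
  exists2 i, Vc i & C = [set j | gsim j i].

Definition class_le (C D : set S) : Prop :=
  exists i j, [/\ C i, D j & exists n, dipath n i j].

Definition maximal_graph_comm_class (C : set S) : Prop :=
  graph_comm_class C /\
  forall D : set S, graph_comm_class D -> class_le C D -> D = C.

End DirectedGraph.

Section Semiflow.
Variables (S : finType) (Phi : nat -> set S -> set S).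

Definition omega_limit (A : set S) : set S :=
  [set y | exists t : nat -> nat,
     (t k @[k --> \oo] --> \oo) /\ forall k, Phi (t k) A y].

Definition attractor (A : set S) : Prop :=
  exists N : set S, A `<=` N /\ omega_limit N = A.

Definition minimal_nonempty_attractor (C : set S) : Prop :=
  [/\ attractor C, C !=set0 &
      forall A : set S, attractor A -> A !=set0 -> A `<=` C -> A = C].

End Semiflow.

Section Associated.
Variables (R : realType) (S : finType) (P : 'M[R]_#|S|).

Definition assoc_graph : rel S := fun i j => 0 < pn P 1 i j.

Definition assoc_semiflow (n : nat) (A : set S) : set S :=
  [set j | exists2 i, A i & 0 < pn P n i j].

Definition chain_communicate (i j : S) : Prop :=
  (exists n, 0 < pn P n i j) /\ (exists m, 0 < pn P m j i).

Definition chain_comm_class (C : set S) : Prop :=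
  exists i, C = [set j | chain_communicate i j].

Definition stochastically_closed (A : set S) : Prop :=
  A !=set0 /\ forall i, A i -> \sum_(j in A) pn P 1 i j = 1.

End Associated.

(* Main.v *)
Require Import Defs.
From mathcomp Require Import all_boot all_order all_algebra.
From mathcomp Require Import all_classical all_reals all_analysis.

(** All three conditions say that [C] is nonempty, closed under the edges of
    [G], and that any two of its points are joined by a path.  Two facts make
    this work: since every row of [P] sums to 1, every vertex has a successor,
    hence by finiteness reaches a cycle; and omega-limit sets are closed under
    edges, while the omega-limit set of a closed set stays inside it. *)

Set Implicit Arguments.
Unset Strict Implicit.
Unset Printing Implicit Defensive.

Import Order.TTheory GRing.Theory Num.Theory.

Local Open Scope classical_set_scope.
Local Open Scope ring_scope.

Definition edge_closed (S : finType) (e : rel S) (A : set S) : Prop :=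
  forall i j, A i -> e i j -> A j.

Lemma dipath0 (S : finType) (e : rel S) i : dipath e 0 i i.
Proof. by exists [::]. Qed.

Lemma dipath1 (S : finType) (e : rel S) i j : e i j -> dipath e 1 i j.
Proof. by move=> eij; exists [:: j]; split=> //=; rewrite eij. Qed.

Lemma dipath_cat (S : finType) (e : rel S) m n i j k :
  dipath e m i j -> dipath e n j k -> dipath e (m + n) i k.
Proof.
move=> [s [<- ps <-]] [t [<- pt <-]]; exists (s ++ t).
by rewrite size_cat cat_path last_cat ps pt.
Qed.

Lemma dipathS (S : finType) (e : rel S) n i j :
  dipath e n.+1 i j <-> exists2 k, dipath e n i k & e k j.
Proof.
split; last first.
  by move=> [k dik ekj]; rewrite -addn1; apply: dipath_cat dik (dipath1 ekj).
case=> s; case/lastP: s => [[]//|s x] [].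
rewrite size_rcons rcons_path last_rcons => -[sn] /andP[ps ex] <-.
by exists (last i s) => //; exists s.
Qed.

Lemma dipath_mul (S : finType) (e : rel S) n k i :
  dipath e n i i -> dipath e (k * n) i i.
Proof.
move=> dii; elim: k => [|k IHk]; first exact: dipath0.
by rewrite mulSn; apply: dipath_cat dii IHk.
Qed.

Lemma edge_closed_dipath (S : finType) (e : rel S) (A : set S) n i j :
  edge_closed e A -> A i -> dipath e n i j -> A j.
Proof.
move=> clA; elim: n j => [|n IHn] j Ai; first by case=> -[|x s] [] //= _ _ <-.
by move=> /dipathS[k dik ekj]; apply: clA ekj; apply: IHn.
Qed.

Lemma gsim_sym (S : finType) (e : rel S) i j : gsim e i j -> gsim e j i.
Proof. by case. Qed.

Lemma gsim_trans (S : finType) (e : rel S) i j k :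
  gsim e i j -> gsim e j k -> gsim e i k.
Proof.
move=> [[a a0 ij] [b b0 ji]] [[c c0 jk] [d d0 kj]]; split.
  by exists (a + c)%N; [rewrite addn_gt0 a0 | apply: dipath_cat jk].
by exists (d + b)%N; [rewrite addn_gt0 d0 | apply: dipath_cat ji].
Qed.

Lemma gsim_refl (S : finType) (e : rel S) i j : gsim e i j -> gsim e i i.
Proof. by move=> ij; apply: gsim_trans (gsim_sym ij). Qed.

(** The two given paths may have length 0, while [gsim] asks for positive lengths; going first round
    the cycle at [i] supplies the missing steps. *)
Lemma dipath_gsim (S : finType) (e : rel S) m n i j : gsim e i i ->
  dipath e m i j -> dipath e n j i -> gsim e i j.
Proof.
move=> [[a a0 ii] _] ij ji; split.
  by exists (a + m)%N; [rewrite addn_gt0 a0 | apply: dipath_cat ij].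
by exists (n + a)%N; [rewrite addn_gt0 a0 orbT | apply: dipath_cat ii].
Qed.

Lemma dipath_iter (S : finType) (e : rel S) (f : S -> S) n i :
  (forall i, e i (f i)) -> dipath e n i (iter n f i).
Proof.
move=> ef; elim: n => [|n IHn]; first exact: dipath0.
by apply/dipathS; exists (iter n f i) => //=.
Qed.

(** Choosing one successor [f i] of each vertex turns a walk into the orbit of a self-map of a
    finite set, and such an orbit returns to an earlier point. *)
Lemma dipath_to_cycle (S : finType) (e : rel S) i :
  (forall i, exists j, e i j) -> exists n j, dipath e n i j /\ gsim e j j.
Proof.
move=> /choice[f ef].
have /trajectP[k ltk eqk] := looping_order f i.
exists k, (iter k f i); split; first exact: dipath_iter.
suff loop : exists2 n, (1 <= n)%N & dipath e n (iter k f i) (iter k f i) by [].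
exists (fingraph.order f i - k)%N; first by rewrite subn_gt0.
(* Only the endpoint is rewritten: it becomes the iterate of [f] of order [fingraph.order f i],
   which is then counted from the [k]-th iterate. *)
rewrite -{2}eqk -{2}(subnK (ltnW ltk)) iterD.
exact: dipath_iter.
Qed.

(** Totality of [e] is what makes maximality force closedness: an edge to a vertex that reaches no
    cycle would leave the class without leading to another class. *)
Lemma maximal_graph_comm_classP (S : finType) (e : rel S) (C : set S) :
  (forall i, exists j, e i j) ->
  maximal_graph_comm_class e C <->
  [/\ C !=set0, edge_closed e C &
      forall i j, C i -> C j -> exists n, dipath e n i j].
Proof.
move=> tot; split=> [[[i [i' ii' ->]] maxC]|[[i Ci] clC trC]].
  have ii := gsim_refl ii'.
  split; [by exists i | move=> k l ki ekl | ]; last first.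
    by move=> j k ji ki; case: (gsim_trans ji (gsim_sym ki)) => -[n _ ?] _;
       exists n.
  (* The successor [l] is not yet known to lie on a cycle, so maximality is applied to the class of
     a vertex [m] on a cycle beyond it. *)
  have [n [m [lm mm]]] := dipath_to_cycle l tot.
  have km := dipath_cat (dipath1 ekl) lm.
  have mi : gsim e m i.
    have eqD : [set j | gsim e j m] = [set j | gsim e j i].
      apply: maxC; first by exists m => //; exists m.
      by exists k, m; split=> //; eexists; apply: km.
    by rewrite -[gsim e m i]/([set j | gsim e j i] m) -eqD.
  have [[a _ {}mi] _] := mi.
  have [_ [c _ ik]] := ki.
  apply: gsim_sym; apply: dipath_gsim (dipath_cat lm mi) => //.
  exact: dipath_cat ik (dipath1 ekl).
(* Paths inside [C] may be empty; leaving [i] along an edge and coming back gives a cycle of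
   positive length, so that [i] lies in [Vc]. *)
have [i1 ei1] := tot i.
have [a i1i] := trC i1 i (clC _ _ Ci ei1) Ci.
have ii : gsim e i i.
  by split; exists (1 + a)%N => //; apply: dipath_cat (dipath1 ei1) i1i.
have eqC j : gsim e j i <-> C j.
  split=> [[_ [n _ ij]]|Cj]; first exact: edge_closed_dipath ij.
  have [m ij] := trC i j Ci Cj; have [n ji] := trC j i Cj Ci.
  exact/gsim_sym/(dipath_gsim ii ij ji).
have defC : C = [set j | gsim e j i] by apply/seteqP; split=> j /eqC.
split; first by exists i => //; exists i.
move=> D [k _ ->] [x [y [Cx yk [n xy]]]].
have /eqC yi : C y := edge_closed_dipath clC Cx xy.
have ki := gsim_trans (gsim_sym yk) yi.
rewrite defC; apply/seteqP; split=> j /= jk; first exact: gsim_trans ki.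
exact: gsim_trans (gsim_sym ki).
Qed.

Section PositiveEntries.
Variables (R : realType) (S : finType) (P : 'M[R]_#|S|).
Hypothesis stP : stochastic_mx P.
Local Notation e := (assoc_graph P).
Local Notation Phi := (assoc_semiflow P).

Lemma pnS n i j : pn P n.+1 i j = \sum_k pn P n i k * pn P 1 k j.
Proof.
rewrite /pn expr1 exprSr -[_ * P]/(_ *m P) mxE.
(* The matrix product sums over ordinals; [enum_rank] carries the sum over to [S]. *)
rewrite [LHS](reindex (@enum_rank S)) //.
exact: onW_bij (@enum_rank_bij S).
Qed.

Lemma pn0 i j : pn P 0 i j = (i == j)%:R.
Proof. by rewrite /pn expr0 -[1]/(1%:M) mxE (inj_eq enum_rank_inj). Qed.

Lemma pn_ge0 n i j : 0 <= pn P n i j.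
Proof.
have [P0 _] := stP; elim: n j => [|n IHn] j; first by rewrite pn0 ler0n.
by rewrite pnS sumr_ge0 // => k _; rewrite mulr_ge0.
Qed.

(** By induction on the last step: with nonnegative entries, a sum of products is positive exactly
    when both factors of some term are. *)
Lemma pn_gt0 n i j : 0 < pn P n i j <-> dipath e n i j.
Proof.
elim: n j => [|n IHn] j.
  rewrite pn0; split=> [|[[|x s] [] //= _ _ <-]]; last by rewrite eqxx ltr01.
  by case: eqP => [->|]; rewrite ?ltxx // => _; apply: dipath0.
rewrite dipathS pnS; split=> [|[k /IHn ik ekj]]; last first.
  rewrite (bigD1 k) //= ltr_pwDl ?mulr_gt0 // sumr_ge0 // => l _.
  by rewrite mulr_ge0 ?pn_ge0.
rewrite lt0r sumr_ge0 => [|k _]; last by rewrite mulr_ge0 ?pn_ge0.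
rewrite psumr_neq0 => [|k _]; last by rewrite mulr_ge0 ?pn_ge0.
rewrite andbT => /hasP[k _ /=]; rewrite lt0r mulf_eq0 negb_or.
move=> /andP[/andP[nz1 nz2] _].
by exists k; [apply/IHn | rewrite /assoc_graph]; rewrite lt0r pn_ge0 andbT.
Qed.

Lemma assoc_graph_total i : exists j, e i j.
Proof.
have [P0 /(_ i) sum1] := stP.
have : \sum_j pn P 1 i j != 0 by rewrite sum1 oner_neq0.
rewrite psumr_neq0 => [/hasP[j _ /= ij]|//]; by exists j.
Qed.

(** Each row sum 1 splits into the mass inside [A] and the mass outside; the outside part is a sum
    of nonnegative terms, so it vanishes iff no edge leaves [A]. *)
Lemma stochastically_closedP (A : set S) :
  stochastically_closed P A <-> A !=set0 /\ edge_closed e A.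
Proof.
have [P0 P1] := stP.
have split_sum i : \sum_(j in A) pn P 1 i j + \sum_(j | j \notin A) pn P 1 i j = 1.
  by rewrite -(P1 i) [RHS](bigID (mem A)).
split=> -[A0 clA]; split=> //.
  move=> i j Ai; apply: contraPP => /asboolPn nAj.
  have jA : j \notin A by apply: contra nAj => /set_mem Aj; apply/asboolP.
  apply/negP; rewrite -leNgt.
  have /eqP := split_sum i; rewrite clA // -subr_eq0 addrAC subrr add0r => /eqP.
  by move=> /psumr_eq0P ->.
move=> i Ai; rewrite -[RHS](split_sum i) [X in _ + X]big1 ?addr0 // => j nAj.
apply/eqP; rewrite eq_le P0 andbT leNgt; apply: contra nAj => eij.
exact/mem_set/(clA i).
Qed.

Lemma chain_communicateP i j : chain_communicate P i j <->
  (exists n, dipath e n i j) /\ (exists n, dipath e n j i).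
Proof.
by split=> -[[n ij] [m ji]]; split; [exists n|exists m|exists n|exists m];
   apply/pn_gt0.
Qed.

(** Both sides allow paths of length 0, so no cycle has to be produced; closedness puts everything
    reachable from [i] back into [C]. *)
Lemma closed_chain_comm_classP (C : set S) :
  stochastically_closed P C /\ chain_comm_class P C <->
  [/\ C !=set0, edge_closed e C &
      forall i j, C i -> C j -> exists n, dipath e n i j].
Proof.
rewrite stochastically_closedP; split=> [[[C0 clC] [i defC]]|[[i Ci] clC trC]].
  split=> // j k; rewrite defC /= => /chain_communicateP[_ [n ji]].
  move=> /chain_communicateP[[m ik] _].
  by exists (n + m)%N; apply: dipath_cat ik.
split; first by split=> //; exists i.
exists i; apply/seteqP; split=> j /= => [Cj|/chain_communicateP[[n ij] _]].
  by apply/chain_communicateP; split; apply: trC.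
exact: edge_closed_dipath ij.
Qed.

Lemma omega_limit_edge_closed (A : set S) : edge_closed e (omega_limit Phi A).
Proof.
(* Following the edge delays every visiting time by one. *)
move=> i j [t [tcvg tA]] eij; exists (fun k => (t k).+1); split.
  apply/cvgnyPge => m; move/cvgnyPge : tcvg => /(_ m).
  by apply: filterS => k /leqW.
move=> k; have [x Ax /pn_gt0 xi] := tA k.
by exists x => //; apply/pn_gt0/dipathS; exists i.
Qed.

Lemma omega_limit_sub_closed (A : set S) :
  edge_closed e A -> omega_limit Phi A `<=` A.
Proof.
move=> clA j [t [_ /(_ 0%N)[i Ai /pn_gt0 ij]]].
exact: edge_closed_dipath ij.
Qed.

(** Going [k] times round a cycle of length [n] at [j] gives visits at the times [m + k * n],
    unbounded because [n] is positive. *)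
Lemma omega_limit_cycle (A : set S) m i j :
  A i -> dipath e m i j -> gsim e j j -> omega_limit Phi A j.
Proof.
move=> Ai ij [[n n0 jj] _]; exists (fun k => m + k * n)%N; split.
  apply/cvgnyPge => N; near=> k.
  rewrite (@leq_trans k) //; first by near: k; exact: nbhs_infty_ge.
  by rewrite (leq_trans (leq_pmulr k n0)) ?leq_addl.
move=> k; exists i => //; apply/pn_gt0.
exact: dipath_cat ij (dipath_mul k jj).
Unshelve. all: by end_near. Qed.

Lemma minimal_nonempty_attractorP (C : set S) :
  minimal_nonempty_attractor Phi C <->
  [/\ C !=set0, edge_closed e C &
      forall i j, C i -> C j -> exists n, dipath e n i j].
Proof.
split=> [[[N [_ defC]] C0 minC]|[[i Ci] clC trC]].
  have clC : edge_closed e C by rewrite -defC; apply: omega_limit_edge_closed.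
  split=> // i j Ci Cj.
  (* The set reachable from [i] is closed and lies in [C], so its omega-limit set is a nonempty
     attractor inside [C]. By minimality it is [C], whence [j] is in [F]. *)
  pose F := [set k | exists n, dipath e n i k].
  have clF : edge_closed e F.
    by move=> k l [n ik] ekl; exists n.+1; apply/dipathS; exists k.
  have FC : F `<=` C by move=> k [n]; apply: edge_closed_dipath.
  have wF := omega_limit_sub_closed clF.
  apply: (wF); rewrite (minC (omega_limit Phi F)) //.
  - by exists F.
  - have [n [k [ik kk]]] := dipath_to_cycle i assoc_graph_total.
    by exists k; apply: omega_limit_cycle ik kk; exists 0%N; apply: dipath0.
  - exact: subset_trans FC.
split; last 1 first.
(* An attractor is closed under edges, so one that meets [C] contains all that is reachable from the
   common point, hence [C]. *)
- move=> A [N [_ defA]] [j Aj] AC; apply/seteqP; split=> // k Ck.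
  have [n jk] := trC j k (AC _ Aj) Ck.
  apply: edge_closed_dipath jk => //.
  by rewrite -defA; apply: omega_limit_edge_closed.
(* [C] is its own neighbourhood [N]: each of its points returns to itself through a successor, so it
   belongs to the omega-limit set. *)
- exists C; split=> //; apply/seteqP; split; first exact: omega_limit_sub_closed.
  move=> j Cj; have [k ejk] := assoc_graph_total j.
  have [n kj] := trC k j (clC _ _ Cj ejk) Cj.
  apply: omega_limit_cycle Cj (dipath0 _ _) _.
  by split; exists n.+1 => //; apply: dipath_cat (dipath1 ejk) kj.
- by exists i.
Qed.

End PositiveEntries.

Theorem fact9 (d : measure_display) (T : measurableType d) (R : realType)
  (Pr : probability T R) (S : finType) (X : nat -> T -> S) (P : 'M[R]_#|S|)
  (hX : markov_chain Pr X P) (C : set S) :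
  (maximal_graph_comm_class (assoc_graph P) C <->
     stochastically_closed P C /\ chain_comm_class P C) /\
  (stochastically_closed P C /\ chain_comm_class P C <->
     minimal_nonempty_attractor (assoc_semiflow P) C).
Proof.
have [stP _ _] := hX.
have := maximal_graph_comm_classP C (assoc_graph_total stP).
have := closed_chain_comm_classP stP C.
have := minimal_nonempty_attractorP stP C.
tauto.
Qed.
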